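(* For all $\varepsilon \in (0,1/7]$, every $\varepsilon$-erasure-resilient $\varepsilon$-tester for connectedness that makes only degree and neighbor queries requires a number of queries linear in the size of the graph representation (i.e., $\Omega(m)$ queries in the worst case over input graphs).
   Context: Graphs are simple and undirected, on a vertex set $V$ with $n=|V|$, represented by adjacency lists. For $\alpha\in[0,1]$, an $\alpha$-erased graph is the concatenation of the adjacency lists of a simple undirected graph $(V,E)$ in which at most $2\alpha|E|$ entries have been replaced by a special symbol $\bot$ (erased). A completion of an $\alpha$-erased graph $G$ is the adjacency-list representation of a simple undirected graph on $V$ that coincides with $G$ on all nonerased entries (list lengths unchanged). $m$ denotes half the total length of all adjacency lists (the number of edges of any completion). Degree query: given $v$, return the length of its adjacency list. Neighbor query: given $(v,i)$, return the $i$-th entry of the adjacency list of $v$ (possibly $\bot$). $G$ is connected if some completion of $G$ is connected; $G$ is $\varepsilon$-far from connected if every completion of $G$ differs in at least $\varepsilon m$ edges from every connected graph. An $\alpha$-erasure-resilient $\varepsilon$-tester for connectedness gets query access to an $\alpha$-erased graph $G$, accepts with probability at least $2/3$ if $G$ is connected, and rejects with probability at least $2/3$ if $G$ is $\varepsilon$-far from connected. *)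

(* Defs.v *)
From HB Require Import structures.
From mathcomp Require Import all_boot all_order all_algebra.
From mathcomp Require Import all_classical all_reals all_analysis.

Set Implicit Arguments.
Unset Strict Implicit.
Unset Printing Implicit Defensive.

Import Order.TTheory GRing.Theory Num.Theory.
Local Open Scope ring_scope.

Definition adj_lists (n : nat) := 'I_n -> seq 'I_n.

(* [None] is the erasure symbol. *)
Definition erased_lists (n : nat) := 'I_n -> seq (option 'I_n).

Definition represents_simple_graph n (L : adj_lists n) : Prop :=
  [/\ forall v, uniq (L v),
      forall v, v \notin L v
    & forall u v, (u \in L v) = (v \in L u)].

Definition completion n (G : erased_lists n) (L : adj_lists n) : Prop :=
  [/\ represents_simple_graph L,
      forall v, size (L v) = size (G v)
    & forall v i u, onth (G v) i = Some (Some u) -> onth (L v) i = Some u].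

(* The total length is even as soon as [G] has a completion, so the halving
   is exact on erased graphs. *)
Definition num_edges n (G : erased_lists n) : nat :=
  (\sum_(v < n) size (G v))%N./2.

Definition num_erased n (G : erased_lists n) : nat :=
  (\sum_(v < n) count_mem None (G v))%N.

Definition erased_graph (R : realType) n (alpha : R) (G : erased_lists n) :
    Prop :=
  (exists L, completion G L) /\
  (num_erased G)%:R <= 2 * alpha * (num_edges G)%:R.

Definition connected_lists n (L : adj_lists n) : Prop :=
  forall u v, connect [rel x y | y \in L x] u v.

Definition edge_set n (L : adj_lists n) : {set {set 'I_n}} :=
  [set [set p.1; p.2] | p : 'I_n * 'I_n & p.2 \in L p.1].

Definition edge_distance n (L1 L2 : adj_lists n) : nat :=
  #|(edge_set L1 :\: edge_set L2) :|: (edge_set L2 :\: edge_set L1)|.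

Definition connected_erased n (G : erased_lists n) : Prop :=
  exists2 L, completion G L & connected_lists L.

Definition far_from_connected (R : realType) n (eps : R) (G : erased_lists n) :
    Prop :=
  forall L, completion G L ->
  forall C, represents_simple_graph C -> connected_lists C ->
    eps * (num_edges G)%:R <= (edge_distance L C)%:R.

(* Deterministic adaptive algorithms on the vertex set ['I_n]. List positions
   are counted from 0. The answer to a neighbor query is [None] beyond the end
   of the list, [Some None] at an erased entry and [Some (Some u)] at a
   nonerased entry [u]. *)
Inductive query_tree (n : nat) : Type :=
| Output of bool
| DegreeQuery of 'I_n & (nat -> query_tree n)
| NeighborQuery of 'I_n & nat & (option (option 'I_n) -> query_tree n).

Fixpoint accepts n (t : query_tree n) (G : erased_lists n) : bool :=
  match t with
  | Output b => b
  | DegreeQuery v k => accepts (k (size (G v))) G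
  | NeighborQuery v i k => accepts (k (onth (G v) i)) G
  end.

Fixpoint num_queries n (t : query_tree n) (G : erased_lists n) : nat :=
  match t with
  | Output _ => 0%N
  | DegreeQuery v k => (num_queries (k (size (G v))) G).+1
  | NeighborQuery v i k => (num_queries (k (onth (G v) i)) G).+1
  end.

(* The coins are drawn from an arbitrary probability space and determine a
   deterministic algorithm. *)
Record randomized_algorithm (R : realType) (n : nat) := RandomizedAlgorithm {
  coin_display : measure_display;
  coins : measurableType coin_display;
  coin_law : probability coins R;
  strategy : coins -> query_tree n;
  measurable_accepts : forall G : erased_lists n,
    measurable [set w : coins | accepts (strategy w) G]%classic;
  measurable_num_queries : forall G : erased_lists n,
    measurable_fun [set: coins]%classic
      (fun w => (num_queries (strategy w) G)%:R : R)
}.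

Section Testers.
Context (R : realType) (n : nat).
Implicit Types (A : randomized_algorithm R n) (G : erased_lists n).

Definition prob_accept A G : \bar R :=
  coin_law A [set w | accepts (strategy (r := A) w) G]%classic.

Definition prob_reject A G : \bar R :=
  coin_law A [set w | ~~ accepts (strategy (r := A) w) G]%classic.

Definition expected_queries A G : \bar R :=
  'E_(coin_law A)[fun w => (num_queries (strategy (r := A) w) G)%:R].

End Testers.

(* Graphs on at most one vertex are left out: they are connected, and also
   eps-far from connected because they have no edge (the required distance is
   0), so no algorithm could satisfy both requirements on them. *)
Definition connectedness_tester (R : realType) (alpha eps : R)
    (A : forall n, randomized_algorithm R n) : Prop :=
  forall n (G : erased_lists n), (1 < n)%N -> erased_graph alpha G ->
    (connected_erased G -> ((2 / 3)%:E <= prob_accept (A n) G)%E) /\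
    (far_from_connected eps G -> ((2 / 3)%:E <= prob_reject (A n) G)%E).

(* Main.v *)
(* Put 2p vertices ("core"), with p = floor(eps m), and attach m - p leaves to
   the core vertex 0. In the base graph G each core vertex has exactly one further
   entry, which is erased. Completions of G match the core perfectly, so G has m
   edges and 2p <= 2 eps m erasures.
   Two graphs differ from G only on a block {4g, ..., 4g+3} of the core. Deleting
   the erased entries of the block leaves m - 2 edges, too few: a connected graph on the
   m + p vertices has at least m + p - 1 edges, hence p + 1 >= eps (m - 2) of them
   are missing. Letting instead the vertex 4g list all other core vertices gives
   a graph that is connected once every erased entry is completed to 4g.
   A tester rejects the first and accepts the second graph with probability at
   least 1/3 under the same coins, which forces it to query block g of G. There
   are p/2 disjoint blocks, so it makes at least p/6 queries to G on average. *)
Require Import Defs.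
From HB Require Import structures.
From mathcomp Require Import all_boot all_order all_algebra.
From mathcomp Require Import all_classical all_reals all_analysis.
From mathcomp Require Import measurable_realfun zify lra.
Set Implicit Arguments.
Unset Strict Implicit.
Unset Printing Implicit Defensive.
Import Order.TTheory GRing.Theory Num.Theory.
Local Open Scope ring_scope.

(** * Locality of query algorithms *)

Fixpoint queried n (t : query_tree n) (G : erased_lists n) : seq 'I_n :=
  match t with
  | Output _ => [::]
  | DegreeQuery v k => v :: queried (k (size (G v))) G
  | NeighborQuery v i k => v :: queried (k (onth (G v) i)) G
  end.

Lemma size_queried n (t : query_tree n) G : size (queried t G) = num_queries t G.
Proof. by elim: t => //= [v k IH|v i k IH]; rewrite IH. Qed.

(** Agreement on the vertices queried in the run on [G] suffices: by induction the run on [H]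
    receives the same answers and follows the same path. *)
Lemma accepts_eq_in n (t : query_tree n) (G H : erased_lists n) :
  {in queried t G, G =1 H} -> accepts t G = accepts t H.
Proof.
elim: t => //= [v k IH|v i k IH] GH.
- rewrite -(GH v) ?mem_head// IH// => u u_in.
  by apply: GH; rewrite inE u_in orbT.
- rewrite -(GH v) ?mem_head// IH// => u u_in.
  by apply: GH; rewrite inE u_in orbT.
Qed.

(** Used to bound the number of distinct blocks hit by the number of queries. *)
Lemma sum_mem_leq_size (T : eqType) (r s : seq T) :
  uniq r -> (\sum_(x <- r) (x \in s) <= size s)%N.
Proof.
move=> r_uniq; rewrite (eq_bigr (fun x => if x \in s then 1 else 0)%N); last first.
  by move=> x _; case: (x \in s).
rewrite -big_mkcond /= -big_filter sum1_size.
apply: uniq_leq_size; first exact: filter_uniq.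
by move=> x; rewrite mem_filter => /andP[].
Qed.

(** * Edge counts and distance to connectedness *)

(* Each vertex v other than the root ord0 has a neighbor [parent v] closer to the
   root; v is the farther endpoint of the edge {v, parent v}, so v is determined
   by that edge. *)
Lemma card_edge_set_connected n (C : adj_lists n) :
  represents_simple_graph C -> connected_lists C -> (n <= #|edge_set C|.+1)%N.
Proof.
case: n C => // n C [_ _ C_sym] C_conn.
(* Walks are tuples of length exactly [d], which makes [reach] a boolean predicate, as [ex_minn]
   requires. *)
pose reach d v := [exists t : d.-tuple 'I_n.+1,
  path [rel x y | y \in C x] v t && (last v t == ord0)].
have ex_reach v : exists d, reach d v.
  have /connectP[s s_path s_last] := C_conn v ord0.
  exists (size s); apply/existsP; exists (in_tuple s).
  by rewrite s_path -s_last eqxx.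
pose dist v := ex_minn (ex_reach v).
have parent_ex v : v != ord0 -> exists u, (u \in C v) && (dist u < dist v)%N.
  move=> v_neq0; rewrite [dist v]/dist; case: ex_minnP => d /existsP[t] + _.
  have := size_tuple t; case: (tval t) => [|u s] /= s_size.
    by move=> /eqP v0; rewrite v0 eqxx in v_neq0.
  case/andP=> /andP[uv s_path] s_last; exists u; rewrite uv /dist.
  case: ex_minnP => d' _ d'_min; rewrite -s_size ltnS; apply: d'_min.
  by apply/existsP; exists (in_tuple s); rewrite s_path.
pose parent v := odflt v [pick u | (u \in C v) && (dist u < dist v)%N].
have parentP v : v != ord0 -> (parent v \in C v) && (dist (parent v) < dist v)%N.
  move=> /parent_ex[u Pu]; rewrite /parent; case: pickP => [//|/(_ u)].
  by rewrite Pu.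
pose f v := [set v; parent v].
have f_inj : {in predC1 (@ord0 n) &, injective f}.
  move=> u v /parentP/andP[_ lt_u] /parentP/andP[_ lt_v] fuv.
  have : u \in f v by rewrite -fuv set21.
  have : v \in f u by rewrite fuv set21.
  rewrite !inE => /orP[/eqP->//|/eqP v_pu] /orP[/eqP//|/eqP u_pv].
  (* Here [u] and [v] are each other's parent, so each would be strictly closer to the root than the
     other. *)
  by move: lt_u lt_v; rewrite -v_pu -u_pv; lia.
have := card_in_imset f_inj; rewrite cardC1 card_ord /= => n_eq.
rewrite ltnS; apply: leq_trans (eq_leq (esym n_eq)) _.
apply/subset_leq_card/fintype.subsetP => e /imsetP[v v_neq0 ->].
apply/imsetP; exists (v, parent v) => //.
by rewrite inE; case/andP: (parentP _ v_neq0).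
Qed.

(** Double counting: the lists hold one entry per ordered adjacent pair, and irreflexivity makes (u,
    v) and (v, u) two distinct pairs over each edge. *)
Lemma card_edge_set_leq n (L : adj_lists n) :
  represents_simple_graph L -> (#|edge_set L|.*2 <= \sum_(v < n) size (L v))%N.
Proof.
case=> L_uniq L_irr L_sym.
pose P := [set p : 'I_n * 'I_n | p.2 \in L p.1].
pose f (p : 'I_n * 'I_n) := [set p.1; p.2].
have -> : (\sum_(v < n) size (L v) = \sum_(p in P) 1)%N.
  rewrite (eq_bigl (fun p => p.2 \in L p.1)); last by move=> p; rewrite inE.
  rewrite -(pair_big_dep predT (fun v u => u \in L v) (fun _ _ => 1%N)) /=.
  apply: eq_bigr => v _; rewrite sum1_card.
  by rewrite -(card_uniqP (L_uniq v)).
rewrite (partition_big f (mem (edge_set L))) /=; last first.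
  by move=> p pP; apply: imset_f.
rewrite -muln2 -sum_nat_const; apply: leq_sum => e /imsetP[[u v]].
rewrite inE /= => uv ->; rewrite sum1_card.
have u_neq_v : u != v by apply: contraTneq uv => ->; exact: L_irr.
have -> : 2%N = #|[set (u, v); (v, u)]|.
  by rewrite cards2 xpair_eqE negb_and u_neq_v.
apply/subset_leq_card/fintype.subsetP => p; rewrite !inE.
move=> /orP[] /eqP->; rewrite unfold_in /= !inE /=.
  by rewrite uv eqxx.
by rewrite -L_sym uv /f /= finset.setUC eqxx.
Qed.

(** [C] has at least n - 1 edges and [L] at most [num_edges G], so the edges of [C] outside [L]
    already give the bound. *)
Lemma edge_distance_connected n (G : erased_lists n) (L C : adj_lists n) :
  completion G L -> represents_simple_graph C -> connected_lists C ->
  (n <= (edge_distance L C + num_edges G).+1)%N.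
Proof.
move=> [L_simple L_size _] C_simple C_conn.
have := card_edge_set_connected C_simple C_conn.
have := card_edge_set_leq L_simple.
rewrite (eq_bigr _ (fun v _ => L_size v)) => L_edges C_edges.
have {}L_edges : (#|edge_set L| <= num_edges G)%N.
  by rewrite -(half_double #|edge_set L|) half_leq.
apply: leq_trans C_edges _; rewrite ltnS.
rewrite -(cardsID (edge_set L) (edge_set C)) addnC leq_add//.
  by apply: subset_leq_card; exact: finset.subsetUr.
by apply: leq_trans L_edges; apply: subset_leq_card; exact: finset.subsetIr.
Qed.

(** * Averaging over the coins *)

Lemma sum_probability_le_expectation (R : realType) d (T : measurableType d)
    (P : probability T R) (I : Type) (r : seq I) (D : I -> set T) (N : T -> nat) :
  (forall i, measurable (D i)) ->
  measurable_fun [set: T] (fun w => (N w)%:R : R) ->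
  (forall w, (\sum_(i <- r) (w \in D i) <= N w)%N) ->
  (\sum_(i <- r) P (D i) <= 'E_P[fun w => (N w)%:R])%E.
Proof.
move=> mD mN le_N; rewrite expectation.unlock.
have -> : (\sum_(i <- r) P (D i) = \int[P]_w \sum_(i <- r) (\1_(D i) w)%:E)%E.
  rewrite ge0_integral_sum//.
  - by apply: eq_bigr => i _; rewrite integral_indic// setIT.
  - by move=> i; apply/measurable_EFinP; exact: measurable_indic.
apply: ge0_le_integral => //.
- by move=> w _; apply: sume_ge0.
- apply: emeasurable_sum => i; apply/measurable_EFinP; exact: measurable_indic.
- by apply/measurable_EFinP.
move=> w _; rewrite sumEFin lee_fin.
under eq_bigr do rewrite indicE.
by rewrite -natr_sum ler_nat.
Qed.

(** Union bound: P(A) <= P(A and B) + P(not B). *)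
Lemma probability_setI_ge (R : realType) d (T : measurableType d)
    (P : probability T R) (A B : set T) (a b : R) :
  measurable A -> measurable B -> (a%:E <= P A)%E -> (b%:E <= P B)%E ->
  ((a + b - 1)%:E <= P (A `&` B)%classic)%E.
Proof.
move=> mA mB aA bB.
have PA : (P A <= P (A `&` B)%classic + P (~` B)%classic)%E.
  apply: (@le_trans _ _ (P ((A `&` B) `|` ~` B)%classic)).
    apply: le_measure; rewrite ?inE//.
      by apply: measurableU; [exact: measurableI|exact: measurableC].
    by move=> w Aw; have [Bw|Bw] := pselect (B w); [left|right].
  by apply: measureU2; [exact: measurableI|exact: measurableC].
rewrite probability_setC// in PA.
have := le_trans aA PA; move: bB.
rewrite -(fineK (fin_num_measure P B mB)).
rewrite -(fineK (fin_num_measure P _ (measurableI _ _ mA mB))).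
rewrite -EFinB -EFinD !lee_fin; lra.
Qed.

(* Coins for which [Gm i] is rejected and [Gp i] accepted must query block [i] of
   [G]. These events, unlike "block [i] is queried", are known to be measurable. *)
Lemma expected_queries_ge (R : realType) n (A : randomized_algorithm R n)
    (G : erased_lists n) (I : eqType) (r : seq I) (block : 'I_n -> I)
    (Gm Gp : I -> erased_lists n) :
  uniq r ->
  {in r, forall i v, block v != i -> Gm i v = G v /\ Gp i v = G v} ->
  {in r, forall i, ((2 / 3)%:E <= prob_reject A (Gm i))%E} ->
  {in r, forall i, ((2 / 3)%:E <= prob_accept A (Gp i))%E} ->
  (((size r)%:R / 3)%:E <= expected_queries A G)%E.
Proof.
move=> r_uniq G_eq rej acc.
pose rejm i := [set w | ~~ accepts (strategy (r := A) w) (Gm i)]%classic.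
pose accp i := [set w | accepts (strategy (r := A) w) (Gp i)]%classic.
have mrej i : measurable (rejm i).
  rewrite (_ : rejm i = ~` [set w | accepts (strategy (r := A) w) (Gm i)])%classic.
    by apply: measurableC; exact: measurable_accepts.
  by apply/seteqP; split=> w /= /negP.
have macc i : measurable (accp i) by exact: measurable_accepts.
pose D i := (rejm i `&` accp i)%classic.
have D_ge i : i \in r -> ((1 / 3)%:E <= coin_law A (D i))%E.
  move=> ir; have := probability_setI_ge (mrej i) (macc i) (rej i ir) (acc i ir).
  by apply: le_trans; rewrite lee_fin; lra.
apply: (@le_trans _ _ (\sum_(i <- r) coin_law A (D i))%E).
  rewrite big_seq; apply: le_trans (lee_sum _ D_ge).
  rewrite -big_seq sumEFin lee_fin big_const_seq count_predT iter_addr_0.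
  by rewrite -mulr_natl; lra.
apply: sum_probability_le_expectation => [i||w].
- exact: measurableI.
- exact: measurable_num_queries.
(* It suffices that the blocks of the queried vertices include every [i] whose event [D i]
   occurs. *)
rewrite -size_queried -(size_map block).
apply: leq_trans (sum_mem_leq_size _ r_uniq).
rewrite big_seq [leqRHS]big_seq; apply: leq_sum => i ir.
case: (boolP (w \in D i)) => // /[!inE] -[/negP rejw accw].
rewrite lt0b; apply: contra_notT rejw => i_notin.
(* If block [i] is missed, the runs on [Gm i], [G] and [Gp i] end alike, although one rejects and
   another accepts. *)
have G_eq_on H : (forall v, block v != i -> H v = G v) ->
    accepts (strategy (r := A) w) G = accepts (strategy (r := A) w) H.
  move=> HG; apply: accepts_eq_in => v v_in; rewrite HG//.
  by apply: contraNneq i_notin => <-; exact: map_f.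
rewrite -G_eq_on; last by move=> v /(G_eq i ir)[].
by rewrite (G_eq_on (Gp i)) // => v /(G_eq i ir)[].
Qed.

(** * Graphs on a core with leaves hung from one vertex *)

Section HungStar.
Variables k M : nat.
Local Notation V := 'I_(k + M).+1.
Implicit Types (u v : V) (f : V -> seq V) (e : pred V).

(** The core has k + 1 vertices, since [k] itself belongs to it. *)
Definition core v := (v <= k)%N.

Definition leaves : seq V := enum [pred v | ~~ core v].

(* The graph [f] on the core, plus the leaves hanging from [ord0]. *)
Definition hung_star f : adj_lists (k + M).+1 := fun v =>
  if core v then (if v == ord0 then leaves else [::]) ++ f v else [:: ord0].

(* [hung_star f] with the [f]-entries in the lists of the vertices of [e] erased. *)
Definition erased_star e f : erased_lists (k + M).+1 := fun v =>
  if core v then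
    (if v == ord0 then map some leaves else [::]) ++
    (if e v then nseq (size (f v)) None else map some (f v))
  else [:: Some ord0].

Definition core_graph f : Prop :=
  (forall v, core v -> [/\ uniq (f v), v \notin f v & {in f v, forall u, core u}])
  /\ (forall u v, core u -> core v -> (u \in f v) = (v \in f u)).

Lemma mem_leaves v : (v \in leaves) = ~~ core v.
Proof. by rewrite mem_enum. Qed.

Lemma hung_star_simple f : core_graph f -> represents_simple_graph (hung_star f).
Proof.
move=> [f_core f_sym]; split=> [v|v|u v]; rewrite /hung_star.
- have [v_core|//] := boolP (core v); have [f_uniq _ f_sub] := f_core _ v_core.
  case: eqP => _ //; rewrite cat_uniq f_uniq enum_uniq /= andbT.
  by apply/hasPn => u /f_sub u_core; rewrite mem_leaves u_core.
- have [v_core|v_leaf] := boolP (core v).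
    have [_ v_nf _] := f_core _ v_core.
    by case: eqP; rewrite ?mem_cat ?mem_leaves ?v_core.
  by rewrite inE; apply: contra v_leaf => /eqP->.
- have [u_core|u_leaf] := boolP (core u); have [v_core|v_leaf] := boolP (core v).
  + by do 2![case: eqP => _]; rewrite ?mem_cat ?mem_leaves ?u_core ?v_core /= f_sym.
  + rewrite inE; have [_ _ f_sub] := f_core _ u_core.
    have -> : (v \in (if u == ord0 then leaves else [::]) ++ f u) = (u == ord0).
      rewrite mem_cat; case: eqP => _; first by rewrite mem_leaves v_leaf.
      by apply: contraNF v_leaf => /f_sub.
    by [].
  + rewrite inE; have [_ _ f_sub] := f_core _ v_core.
    rewrite mem_cat; case: eqP => _; first by rewrite mem_leaves u_leaf.
    by apply: contraNF u_leaf => /f_sub.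
  + rewrite !inE; apply/eqP/eqP => w0.
      by rewrite w0 /core in u_leaf.
    by rewrite w0 /core in v_leaf.
Qed.

Lemma erased_star_completion e f :
  core_graph f -> completion (erased_star e f) (hung_star f).
Proof.
move=> f_core; split; first exact: hung_star_simple.
- move=> v; rewrite /hung_star /erased_star; case: ifP => // _.
  rewrite !size_cat; congr (_ + _)%N; first by case: ifP; rewrite ?size_map.
  by case: ifP; rewrite ?size_nseq ?size_map.
- have onth_somes (s : seq V) i u :
      onth (map some s) i = Some (Some u) -> onth s i = Some u.
    by rewrite onth_map; case: (onth s i) => //= ? [->].
  move=> v i u; rewrite /hung_star /erased_star; case: ifP => [_|_]; last first.
    exact: (onth_somes [:: ord0]).
  have -> : (if v == ord0 then map some leaves else [::]) =
      map some (if v == ord0 then leaves else [::]) by case: ifP.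
  rewrite !onth_cat size_map; case: ifP => _; first exact: onth_somes.
  case: ifP => _; last exact: onth_somes.
  by rewrite onth_nseq; case: ifP.
Qed.

Lemma card_core : #|[pred v | core v]| = k.+1.
Proof.
have le_kM : (k.+1 <= (k + M).+1)%N by rewrite ltnS leq_addr.
by rewrite -sum1_card -(big_ord_widen _ (fun=> 1%N) le_kM) sum1_card card_ord.
Qed.

Lemma size_leaves : size leaves = M.
Proof.
rewrite -cardE; have := cardC [pred v | core v]; rewrite card_core card_ord.
exact: (@addnI k.+1).
Qed.

Lemma sum_star (a : V -> nat) (b : nat) :
  (\sum_v (if core v then (if v == ord0 then M else 0) + a v else b))%N =
  (M + \sum_(v | core v) a v + M * b)%N.
Proof.
rewrite (bigID core) /=; congr (_ + _)%N.
  rewrite (eq_bigr (fun v => (if v == ord0 then M else 0) + a v)%N); last first.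
    by move=> v ->.
  rewrite big_split /= -big_mkcondr /= (big_pred1 ord0) // => v /=.
  by case: eqP => [->|]; rewrite ?andbF.
rewrite (eq_bigr (fun=> b)); last by move=> v /negPf->.
by rewrite sum_nat_const -[in RHS]size_leaves -cardE.
Qed.

Lemma num_edges_erased_star e f :
  num_edges (erased_star e f) = (M + (\sum_(v | core v) size (f v))./2)%N.
Proof.
have sizeE v : size (erased_star e f v) =
    (if core v then (if v == ord0 then M else 0) + size (f v) else 1)%N.
  rewrite /erased_star; case: ifP => // _; rewrite size_cat; congr (_ + _)%N.
    by case: ifP => // _; rewrite size_map size_leaves.
  by case: ifP => _; rewrite ?size_nseq ?size_map.
rewrite /num_edges (eq_bigr _ (fun v _ => sizeE v)).
by rewrite sum_star muln1; lia.
Qed.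

Lemma num_erased_erased_star e f :
  num_erased (erased_star e f) = (\sum_(v | core v && e v) size (f v))%N.
Proof.
have count_somes (s : seq V) : count_mem None (map some s) = 0%N.
  by rewrite count_map; apply/eqP; rewrite -leqn0 leqNgt -has_count; apply/hasPn.
rewrite /num_erased [RHS]big_mkcondr [RHS]big_mkcond /=; apply: eq_bigr => v _.
rewrite /erased_star; case: ifP => // _; rewrite count_cat.
have -> : count_mem None (if v == ord0 then map some leaves else [::]) = 0%N.
  by case: ifP.
by case: ifP => _; rewrite ?count_somes// count_nseq /= mul1n.
Qed.

(** * The base graph and its two variants on a block *)

(** Pairs 2i with 2i + 1; an odd [k] keeps both ends in the core. *)
Definition partner v : V := inord (if odd v then v.-1 else v.+1).

Definition matching v := [:: partner v].
(** Block [g] is {4g, ..., 4g+3}, that is, two whole pairs of the matching. *)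
Definition gap_matching g v := if (v %/ 4 == g)%N then [::] else [:: partner v].

Definition hub g : V := inord (4 * g).
Definition hub_star g v :=
  if v == hub g then enum [pred u | core u & u != hub g] else [:: hub g].

Definition base_graph := erased_star predT matching.
Definition far_graph g := erased_star predT (gap_matching g).
(** The hub's own list stays visible; at every other core vertex the entry naming the hub is
    erased. *)
Definition near_graph g := erased_star (predC1 (hub g)) (hub_star g).

Lemma sum_matching : (\sum_(v | core v) size (matching v) = k.+1)%N.
Proof. by rewrite sum1_card card_core. Qed.

Lemma num_erased_base_graph : num_erased base_graph = k.+1.
Proof.
rewrite num_erased_erased_star (eq_bigl core) ?sum_matching// => v.
by rewrite andbT.
Qed.

Section Block.
Variable g : nat.
Hypothesis g_le : (4 * g + 3 <= k)%N.

Lemma hubE : hub g = (4 * g)%N :> nat.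
Proof. by rewrite inordK//; lia. Qed.

Lemma hub_core : core (hub g).
Proof. by rewrite /core hubE; lia. Qed.

Lemma far_graph_base v : (v %/ 4 != g)%N -> far_graph g v = base_graph v.
Proof.
by move=> v_g; rewrite /far_graph /base_graph /erased_star /gap_matching (negPf v_g).
Qed.

(** Outside the block both graphs give a core vertex one core neighbor, and the erasure hides
    whether it is the partner or the hub. *)
Lemma near_graph_base v : (v %/ 4 != g)%N -> near_graph g v = base_graph v.
Proof.
move=> v_g; have v_hub : v != hub g.
  by apply: contraNneq v_g => ->; rewrite hubE mulKn.
by rewrite /near_graph /base_graph /erased_star /hub_star /= (negPf v_hub).
Qed.

Lemma card_block : #|[pred v : V | (v %/ 4 == g)%N]| = 4%N.
Proof.
pose b (i : 'I_4) : V := inord (4 * g + i).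
have bE i : b i = (4 * g + i)%N :> nat by rewrite inordK//; have := ltn_ord i; lia.
have b_inj : injective b.
  by move=> i j /(congr1 val) /=; rewrite !bE => /addnI /val_inj.
rewrite -[RHS]card_ord -(card_codom b_inj); apply: eq_card => v; rewrite !inE.
apply/eqP/codomP => [v_g|[i ->]]; last by rewrite bE; have := ltn_ord i; lia.
have lt4 : (v - 4 * g < 4)%N by lia.
by exists (Ordinal lt4); apply: val_inj; rewrite /= bE /=; lia.
Qed.

Lemma sum_gap_matching : (\sum_(v | core v) size (gap_matching g v) = k - 3)%N.
Proof.
rewrite (eq_bigr (fun v => if v %/ 4 != g then 1 else 0)%N); last first.
  by move=> v _; rewrite /gap_matching; case: ifP.
rewrite -big_mkcondr /= sum1_card.
pose B := [pred v : V | (v %/ 4 == g)%N].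
have := cardID B [pred v | core v].
(* The bound 4g + 3 <= k puts the whole block inside the core. *)
have -> : #|[predI [pred v | core v] & B]| = 4%N.
  rewrite -card_block; apply: eq_card => v; rewrite !inE /core.
  by case: eqP => // v_g; rewrite ?andbT ?andbF; lia.
have -> : #|[predD [pred v | core v] & B]| =
    #|[pred v | core v & (v %/ 4 != g)%N]|.
  by apply: eq_card => v; rewrite !inE andbC.
rewrite card_core; move: #|_| => c; lia.
Qed.

Lemma hub_star_core_graph : core_graph (hub_star g).
Proof.
split=> [v v_core|u v u_core v_core]; rewrite /hub_star.
  case: eqVneq => [->|v_hub].
    rewrite enum_uniq mem_enum inE eqxx andbF; split=> //.
    by move=> u; rewrite mem_enum => /andP[].
  split; rewrite // ?inE// => u /[!inE] /eqP->; exact: hub_core.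
have [->|u_hub] := eqVneq u (hub g); have [->|v_hub] := eqVneq v (hub g).
- by [].
- by rewrite mem_enum !inE eqxx v_core v_hub.
- by rewrite mem_enum !inE eqxx u_core u_hub.
- by rewrite !inE (negPf u_hub) (negPf v_hub).
Qed.

Lemma card_core_not_hub : #|[pred v | core v & v != hub g]| = k.
Proof.
have := cardD1 (hub g) [pred v | core v].
rewrite card_core !inE hub_core add1n => -[k_eq]; rewrite [RHS]k_eq.
by apply: eq_card => v; rewrite !inE andbC.
Qed.

Lemma sum_hub_star : (\sum_(v | core v) size (hub_star g v) = k + k)%N.
Proof.
rewrite (bigD1 (hub g)) ?hub_core//= /hub_star eqxx; congr (_ + _)%N.
  by rewrite -cardE card_core_not_hub.
rewrite (eq_bigr (fun=> 1%N)); last by move=> v /andP[_ /negPf->].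
by rewrite sum1_card card_core_not_hub.
Qed.

Lemma num_erased_near_graph : num_erased (near_graph g) = k.
Proof.
rewrite num_erased_erased_star (eq_bigr (fun=> 1%N)); last first.
  by move=> v /andP[_ /= /negPf v_hub]; rewrite /hub_star v_hub.
by rewrite sum1_card card_core_not_hub.
Qed.

(** Core vertices other than the hub are adjacent to it, and leaves reach it through [ord0]. *)
Lemma connected_near_graph : connected_erased (near_graph g).
Proof.
have L_compl := erased_star_completion (predC1 (hub g)) hub_star_core_graph.
exists (hung_star (hub_star g)) => //; set L := hung_star _ in L_compl *.
have [[_ _ L_sym] _ _] := L_compl.
have conn_sym : connect_sym [rel x y | y \in L x].
  by apply: sym_connect_sym => x y /=; rewrite L_sym.
have core_hub v : core v -> connect [rel x y | y \in L x] v (hub g).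
  move=> v_core; have [->//|v_hub] := eqVneq v (hub g).
  apply: connect1; rewrite /= /L /hung_star v_core mem_cat /hub_star.
  by rewrite (negPf v_hub) inE eqxx orbT.
have to_hub v : connect [rel x y | y \in L x] v (hub g).
  have [/core_hub//|v_leaf] := boolP (core v).
  apply: connect_trans (core_hub ord0 _) => //; apply: connect1.
  by rewrite /= /L /hung_star (negPf v_leaf) inE.
by move=> u v; apply: connect_trans (to_hub u) _; rewrite conn_sym.
Qed.

End Block.
Hypothesis k_odd : odd k.

Lemma partnerE v : core v -> partner v = (if odd v then v.-1 else v.+1) :> nat.
Proof.
rewrite /core => v_core; rewrite inordK//; case: ifPn => v_odd; first by lia.
by rewrite !ltnS ltn_neqAle; lia.
Qed.

Lemma partner_core v : core v -> core (partner v).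
Proof.
move=> v_core; rewrite /core partnerE//; move: v_core; rewrite /core.
by case: ifP; move: k_odd; lia.
Qed.

Lemma partnerK v : core v -> partner (partner v) = v.
Proof.
move=> v_core; apply: val_inj; rewrite /= partnerE ?partner_core// partnerE//.
by case v_odd: (odd v) => /=; case: ifP; lia.
Qed.

(** Blocks start at even numbers, so no pair straddles two of them; emptying a block therefore keeps
    the lists symmetric. *)
Lemma partner_block v : core v -> (partner v %/ 4 = v %/ 4)%N.
Proof. by move=> v_core; rewrite partnerE//; case: ifP; lia. Qed.

Lemma partner_sym u v : core u -> core v -> (u == partner v) = (v == partner u).
Proof. by move=> u_core v_core; apply/eqP/eqP => ->; rewrite partnerK. Qed.

Lemma partner_neq v : core v -> v != partner v.
Proof. by move=> v_core; rewrite -val_eqE /= partnerE//; case: ifP; lia. Qed.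

Lemma matching_core_graph : core_graph matching.
Proof.
split=> [v v_core|u v u_core v_core]; rewrite /matching.
  split=> //; first by rewrite inE partner_neq.
  by move=> u /[!inE] /eqP->; exact: partner_core.
by rewrite !inE partner_sym.
Qed.

Lemma gap_matching_core_graph g : core_graph (gap_matching g).
Proof.
split=> [v v_core|u v u_core v_core]; rewrite /gap_matching.
  case: ifP => // _; split=> //; first by rewrite inE partner_neq.
  by move=> u /[!inE] /eqP->; exact: partner_core.
have [uv|u_neq] := eqVneq u (partner v).
  by rewrite uv partner_block// partnerK//; case: ifP; rewrite ?inE ?eqxx.
have v_neq : v != partner u by rewrite -partner_sym.
by do 2!case: ifP => _; rewrite ?inE ?(negPf u_neq) ?(negPf v_neq).
Qed.

End HungStar.
Arguments base_graph : clear implicits.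
Arguments far_graph : clear implicits.
Arguments near_graph : clear implicits.

(** * Farness and the linear lower bound *)

(** There are k + M + 1 vertices but only M + (k - 3)/2 edges, rounded down, so a connected graph
    has at least (k + 1)/2 + 1 new edges. *)
Lemma far_graph_far (R : realType) (eps : R) k M g :
  (4 * g + 3 <= k)%N ->
  eps * (num_edges (far_graph k M g))%:R <= (k.+1./2).+1%:R ->
  far_from_connected eps (far_graph k M g).
Proof.
move=> g_le eps_le L L_compl C C_simple C_conn.
apply: le_trans eps_le _; rewrite ler_nat.
have := edge_distance_connected L_compl C_simple C_conn.
rewrite num_edges_erased_star (sum_gap_matching M g_le); lia.
Qed.

Theorem theorem1p3 (R : realType) (eps : R) (heps0 : 0 < eps)
    (heps : eps <= 1 / 7) :
  exists2 c : R, 0 < c &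
  exists m0 : nat,
    forall A : (forall n : nat, randomized_algorithm R n),
      connectedness_tester eps eps A ->
    forall m : nat, (m0 <= m)%N ->
    exists (n : nat) (G : erased_lists n),
      [/\ (1 < n)%N, erased_graph eps G, num_edges G = m
        & ((c * m%:R)%:E <= expected_queries (A n) G)%E].
Proof.
(* At least eps m / 4 blocks will each contribute 1/3 to the lower bound. *)
exists (eps / 12); first by lra.
(* Ensures eps m >= 4, which absorbs the rounding in [p] and [K]. *)
exists (Num.truncn (4 / eps)).+1 => A A_tester m m_ge.
have eps_m : 4 <= eps * m%:R.
  rewrite mulrC -ler_pdivrMr// ltW//; apply: lt_le_trans (truncnS_gt _) _.
  by rewrite ler_nat.
pose p := Num.truncn (eps * m%:R).
have /andP[p_le p_gt] : p%:R <= eps * m%:R < p.+1%:R.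
  by apply: truncn_itv; lra.
have p_ge : (4 <= p)%N.
  by rewrite -ltnS -(ltr_nat R); apply: le_lt_trans p_gt.
have p_lem : (p <= m)%N.
  rewrite -(ler_nat R); apply: le_trans p_le _.
  by rewrite ler_piMl//; lra.
(* The core is {0, ..., 2p - 1}; the M leaf edges and p matching edges add up to m. *)
pose k := p.*2.-1; pose M := (m - p)%N.
have k_odd : odd k by rewrite /k; lia.
have k_half : (k.+1./2 = p)%N by rewrite /k; lia.
have base_edges : num_edges (base_graph k M) = m.
  by rewrite num_edges_erased_star sum_matching k_half /M; lia.
exists (k + M).+1, (base_graph k M); split=> //.
- by rewrite /k; lia.
- split.
    by eexists; apply: erased_star_completion; exact: matching_core_graph.
  rewrite num_erased_base_graph base_edges.
  have -> : k.+1 = (2 * p)%N by rewrite /k; lia.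
  by rewrite natrM -mulrA ler_wpM2l.
(* Number of full blocks of four among the 2p core vertices. *)
pose K := p./2.
have K_ge : eps / 4 * m%:R <= K%:R.
  have : (p.+1)%:R <= 2 * K%:R + 2 :> R.
    by rewrite -natrM -natrD ler_nat /K; lia.
  lra.
have blockP g : g \in iota 0 K -> (4 * g + 3 <= k)%N.
  by rewrite mem_iota /K /k; lia.
apply: le_trans (expected_queries_ge (r := iota 0 K)
  (block := fun v : 'I_(k + M).+1 => (v %/ 4)%N)
  (Gm := far_graph k M) (Gp := near_graph k M) (iota_uniq 0 K) _ _ _).
- by rewrite size_iota lee_fin; lra.
- move=> g /blockP g_le v v_g.
  by rewrite far_graph_base// near_graph_base.
- move=> g /blockP g_le.
  have far_edges : num_edges (far_graph k M g) = (m - 2)%N.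
    rewrite num_edges_erased_star (sum_gap_matching M g_le).
    by rewrite /M /k; lia.
  have far_edgesR : (num_edges (far_graph k M g))%:R = m%:R - 2 :> R.
    by rewrite far_edges natrB//; lia.
  apply: (proj2 (A_tester _ (far_graph k M g) _ _)); first by rewrite /k; lia.
    split.
      by eexists; apply: erased_star_completion; exact: gap_matching_core_graph.
    rewrite far_edgesR num_erased_erased_star.
    rewrite (eq_bigl (@core k M)); last by move=> v; rewrite andbT.
    rewrite (sum_gap_matching M g_le).
    have -> : (k - 3 = 2 * p - 4)%N by rewrite /k; lia.
    (* 2p - 4 <= 2 eps (m - 2) follows from p <= eps m and eps <= 1. *)
    by rewrite natrB ?natrM; [nra|lia].
  apply: far_graph_far => //.
  (* eps (m - 2) <= p + 1 because eps m < p + 1. *)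
  by rewrite far_edgesR k_half -natr1; move: p_gt; rewrite -natr1; nra.
- move=> g /blockP g_le.
  have near_compl := erased_star_completion (predC1 (hub k M g))
    (hub_star_core_graph M g_le).
  apply: (proj1 (A_tester _ (near_graph k M g) _ _)).
  + by rewrite /k; lia.
  + split; first by eexists; exact: near_compl.
    (* There are 2p - 1 erasures and M + k = m + p - 1 >= m edges. *)
    rewrite num_erased_near_graph// num_edges_erased_star sum_hub_star//.
    have k_le : (k%:R : R) <= 2 * p%:R by rewrite -natrM ler_nat /k; lia.
    have m_le : (m%:R : R) <= (M + (k + k)./2)%:R.
      by rewrite ler_nat /M /k; lia.
    by have := ler_wpM2l (ltW heps0) m_le; lra.
  + exact: connected_near_graph.
Qed.
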